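(* For $K\in\mathbb{N}$ and $\gamma\in\mathcal{D}(\mathbf{2}\times\mathbf{2})$ one has, for all $i,j\in\{1,2\}$, $$\mathrm{var}\big(\mathrm{bvbn}[K](\gamma),\Pi_i\big)=K\cdot\mathrm{var}(\gamma,\pi_i)\qquad\text{and}\qquad \mathrm{cov}\big(\mathrm{bvbn}[K](\gamma),\Pi_i,\Pi_j\big)=K\cdot\mathrm{cov}(\gamma,\pi_i,\pi_j).$$
   Context: $\mathbf{2}=\{0,1\}$. For a set $X$, $\mathcal{D}(X)$ is the set of finitely supported probability distributions on $X$, i.e. functions $\omega\colon X\to[0,1]$ with finite support and $\sum_x\omega(x)=1$. For $f\colon X\to Y$, $\mathcal{D}(f)\colon\mathcal{D}(X)\to\mathcal{D}(Y)$ is the pushforward $\mathcal{D}(f)(\omega)(y)=\sum_{x\in f^{-1}(y)}\omega(x)$. For $\omega\in\mathcal{D}(X)$ and an observable $p\colon X\to\mathbb{R}$ the validity (expected value) is $(\omega\models p)=\sum_{x}\omega(x)p(x)$. For observables $p,q\colon X\to\mathbb{R}$, $p\mathbin{\&}q$ denotes their pointwise product, and $$\mathrm{var}(\omega,p)=(\omega\models p\mathbin{\&}p)-(\omega\models p)^2,\qquad \mathrm{cov}(\omega,p,q)=(\omega\models p\mathbin{\&}q)-(\omega\models p)\cdot(\omega\models q).$$ The projections $\pi_1,\pi_2\colon\mathbf{2}\times\mathbf{2}\to\mathbf{2}$ and $\Pi_1,\Pi_2\colon\{0,\ldots,K\}\times\{0,\ldots,K\}\to\{0,\ldots,K\}$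 are regarded as real-valued observables. $\mathcal{M}[K](X)$ is the set of multisets over $X$ of size $K$, i.e. finitely supported functions $\varphi\colon X\to\mathbb{N}$ with $\sum_x\varphi(x)=K$. For $\omega\in\mathcal{D}(X)$ with $X$ finite, the multinomial distribution $\mathrm{mn}[K](\omega)\in\mathcal{D}(\mathcal{M}[K](X))$ is $$\mathrm{mn}[K](\omega)(\varphi)=\frac{K!}{\prod_x\varphi(x)!}\prod_{x\in X}\omega(x)^{\varphi(x)}\qquad(0^0=1).$$ The marginal heads function $\mathrm{heads}\colon\mathcal{M}[K](\mathbf{2}\times\mathbf{2})\to\{0,\ldots,K\}\times\{0,\ldots,K\}$ is $\mathrm{heads}(\varphi)=\big(\varphi(1,0)+\varphi(1,1),\ \varphi(0,1)+\varphi(1,1)\big)$. The bivariate binomial distribution of $\gamma\in\mathcal{D}(\mathbf{2}\times\mathbf{2})$ with $K$ tosses is $$\mathrm{bvbn}[K](\gamma)=\mathcal{D}(\mathrm{heads})\big(\mathrm{mn}[K](\gamma)\big)\in\mathcal{D}\big(\{0,\ldots,K\}\times\{0,\ldots,K\}\big).$$ *)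

(* Defs.v *)
From HB Require Import structures.
From mathcomp Require Import all_boot all_order all_algebra.
From mathcomp Require Import reals ring.

Set Implicit Arguments.
Unset Strict Implicit.
Unset Printing Implicit Defensive.

Import Order.TTheory GRing.Theory Num.Theory.
Local Open Scope ring_scope.

(* Distributions on a finite set, so that the finite-support condition is
   automatic; every distribution used below lives on a finite set. *)
Record dist (R : realType) (X : finType) := Dist {
  dist_fun :> X -> R;
  dist_itv : forall x, 0 <= dist_fun x <= 1;
  dist_sum1 : \sum_x dist_fun x = 1 }.

Lemma dist_itv_of_sum1 (R : realType) (X : finType) (w : X -> R) :
  (forall x, 0 <= w x) -> \sum_x w x = 1 -> forall x, 0 <= w x <= 1.
Proof.
move=> w0 w1 x; rewrite w0 /= -w1 (bigD1 x) //= lerDl.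
exact: sumr_ge0.
Qed.

Section Pushforward.
Variables (R : realType) (X Y : finType) (f : X -> Y) (w : dist R X).

Definition push_fun (y : Y) : R := \sum_(x | f x == y) w x.

Lemma push_fun_sum1 : \sum_y push_fun y = 1.
Proof.
by rewrite -(dist_sum1 w) [RHS](partition_big f xpredT).
Qed.

Lemma push_fun_itv y : 0 <= push_fun y <= 1.
Proof.
apply: dist_itv_of_sum1 push_fun_sum1 y => y.
by apply: sumr_ge0 => x _; case/andP: (dist_itv w x).
Qed.

Definition push : dist R Y := Dist push_fun_itv push_fun_sum1.

End Pushforward.

Definition validity (R : realType) (X : finType) (w : dist R X) (p : X -> R) : R :=
  \sum_x w x * p x.

Definition var (R : realType) (X : finType) (w : dist R X) (p : X -> R) : R :=
  validity w (p \* p) - validity w p ^+ 2.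

Definition cov (R : realType) (X : finType) (w : dist R X) (p q : X -> R) : R :=
  validity w (p \* q) - validity w p * validity w q.

(* Multisets of size K over a finite X. Multiplicities in such a multiset are
   at most K, so taking them in 'I_K.+1 loses nothing and makes the type
   finite. *)
Record mset (K : nat) (X : finType) := MSet {
  mset_val :> {ffun X -> 'I_K.+1};
  _ : (\sum_x mset_val x == K)%N }.

HB.instance Definition _ (K : nat) (X : finType) :=
  [isSub for @mset_val K X].
HB.instance Definition _ (K : nat) (X : finType) :=
  [Finite of mset K X by <:].

Lemma mset_size (K : nat) (X : finType) (phi : mset K X) :
  (\sum_x phi x)%N = K.
Proof. by case: phi => phi /= /eqP. Qed.

Section MultinomialTheorem.
Variables (R : numFieldType) (X : finType) (w : X -> R) (N : nat).
Implicit Types (phi psi : {ffun X -> 'I_N.+1}) (x : X).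

Let term phi : R := \prod_x (w x ^+ phi x / (phi x)`!%:R).
Let incr x phi : {ffun X -> 'I_N.+1} :=
  [ffun y => if y == x then inord (phi y).+1 else phi y].
Let decr x phi : {ffun X -> 'I_N.+1} :=
  [ffun y => if y == x then inord (phi y).-1 else phi y].

Let sum_incr x phi : (phi x < N)%N ->
  (\sum_y incr x phi y)%N = (\sum_y phi y).+1.
Proof.
move=> lt; rewrite (bigD1 x) //= [in RHS](bigD1 x) //= ffunE eqxx inordK //.
by rewrite addSn; congr (_ + _).+1; apply: eq_bigr => y /negPf e; rewrite ffunE e.
Qed.

Let term_incr x phi : (phi x < N)%N ->
  (incr x phi x)%:R * term (incr x phi) = w x * term phi.
Proof.
move=> lt; rewrite /term (bigD1 x) //= [in RHS](bigD1 x) //= ffunE eqxx inordK //.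
rewrite !mulrA; congr (_ * _).
  rewrite factS natrM exprS; field.
  by rewrite nat1r !pnatr_eq0 -lt0n fact_gt0.
by apply: eq_bigr => y /negPf e; rewrite ffunE e.
Qed.

Lemma multinomial_bounded k : (k <= N)%N ->
  \sum_(phi : {ffun X -> 'I_N.+1} | (\sum_x phi x == k)%N)
     \prod_x (w x ^+ phi x / (phi x)`!%:R) = (\sum_x w x) ^+ k / k`!%:R.
Proof.
elim: k => [_|k IH lt].
  rewrite (big_pred1 [ffun => ord0]) => [|phi /=].
    by rewrite big1 ?divr1 // => x _; rewrite ffunE expr0 divr1.
  rewrite sum_nat_eq0; apply/forallP/eqP => [h|-> x]; last by rewrite ffunE.
  by apply/ffunP=> x; rewrite ffunE; apply/val_inj/eqP; exact: h.
have k0 : k.+1%:R != 0 :> R by rewrite pnatr_eq0.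
apply: (mulfI k0).
transitivity (\sum_(phi : {ffun X -> 'I_N.+1} | (\sum_x phi x == k.+1)%N)
                \sum_x (phi x)%:R * term phi).
  rewrite mulr_sumr; apply: eq_bigr => phi /eqP <-.
  by rewrite natr_sum mulr_suml.
rewrite exchange_big /=.
transitivity (\sum_x w x * ((\sum_x w x) ^+ k / k`!%:R)); last first.
  rewrite -mulr_suml exprS factS natrM; field.
  by rewrite nat1r !pnatr_eq0 -lt0n fact_gt0.
apply: eq_bigr => x _; rewrite -IH 1?ltnW // mulr_sumr.
rewrite (bigID (fun phi => 0 < phi x)%N) /= [X in _ + X]big1 ?addr0; last first.
  by move=> phi /andP[_]; rewrite lt0n negbK => /eqP ->; rewrite mul0r.
rewrite (reindex_onto (incr x) (decr x)) /=; last first.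
  move=> phi /andP[_ p0]; apply/ffunP=> y; rewrite !ffunE.
  case: eqP => // ->; apply: val_inj.
  have pred_lt : ((phi x).-1 < N.+1)%N.
    exact: leq_ltn_trans (leq_pred _) (ltn_ord _).
  by rewrite /= !(inordK pred_lt) prednK // inordK.
have key phi : (phi x < N)%N -> decr x (incr x phi) = phi.
  move=> ltx; apply/ffunP=> y; rewrite !ffunE; case: eqP => // ->.
  by apply: val_inj; rewrite /= !inordK //= ltnW.
have small phi : (\sum_y phi y == k)%N -> (phi x < N)%N.
  move=> /eqP s; apply: leq_ltn_trans lt; rewrite -s (bigD1 x) //=; exact: leq_addr.
rewrite (eq_bigl (fun phi => (\sum_y phi y == k)%N)).
  by move=> /=; apply: eq_bigr => phi /small; exact: term_incr.
move=> phi; apply/idP/idP.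
  move=> /andP[/andP[s p0] _].
  have ltx : (phi x < N)%N.
    rewrite ltnNge; apply/negP => le; move: p0; rewrite ffunE eqxx.
    have -> : nat_of_ord (phi x) = N by apply/eqP; rewrite eqn_leq le -ltnS ltn_ord.
    by rewrite /inord /insubd insubF ?ltnn.
  by move: s; rewrite sum_incr.
move=> s; have ltx := small _ s.
by rewrite sum_incr // eqSS s key // eqxx andbT /= ffunE eqxx inordK.
Qed.

End MultinomialTheorem.

Section Multinomial.
Variables (R : realType) (X : finType) (K : nat) (w : dist R X).

Definition mn_fun (phi : mset K X) : R :=
  K`!%:R / (\prod_x (phi x)`!)%N%:R * \prod_x w x ^+ phi x.

Lemma mn_fun_sum1 : \sum_phi mn_fun phi = 1.
Proof.
transitivity (K`!%:R *
  \sum_(phi : {ffun X -> 'I_K.+1} | (\sum_x phi x == K)%N)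
     \prod_x (w x ^+ phi x / (phi x)`!%:R)).
  rewrite mulr_sumr (reindex_omap (@mset_val K X) insub) /=; last first.
    by move=> phi szphi; rewrite insubT.
  rewrite [RHS](eq_bigl xpredT) => [|phi]; last first.
    by rewrite mset_size eqxx /= (valK phi) eqxx.
  apply: eq_bigr => phi _; rewrite /mn_fun -mulrA; congr (_ * _).
  by rewrite big_split /= mulrC prodfV natr_prod.
rewrite multinomial_bounded // dist_sum1 expr1n mul1r divff //.
by rewrite pnatr_eq0 -lt0n fact_gt0.
Qed.

Lemma mn_fun_itv phi : 0 <= mn_fun phi <= 1.
Proof.
apply: dist_itv_of_sum1 mn_fun_sum1 phi => phi.
rewrite mulr_ge0 ?divr_ge0 ?ler0n //; apply: prodr_ge0 => x _.
by apply: exprn_ge0; case/andP: (dist_itv w x).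
Qed.

Definition mn : dist R (mset K X) := Dist mn_fun_itv mn_fun_sum1.

End Multinomial.
Arguments mn {R X} K w.

Section Heads.
Variables (K : nat) (phi : mset K ('I_2 * 'I_2)%type).

Lemma heads_bound (a b : 'I_2 * 'I_2) : a != b -> (phi a + phi b < K.+1)%N.
Proof.
move=> ab; rewrite ltnS -[leqRHS](mset_size phi) (bigD1 a) //= leq_add2l.
by rewrite (bigD1 b) 1?eq_sym //= leq_addr.
Qed.

Definition heads : 'I_K.+1 * 'I_K.+1 :=
  (@Ordinal K.+1 (phi (1, 0)%R + phi (1, 1)%R)%N (@heads_bound (1, 0) (1, 1) isT),
   @Ordinal K.+1 (phi (0, 1)%R + phi (1, 1)%R)%N (@heads_bound (0, 1) (1, 1) isT)).

End Heads.

Definition bvbn (R : realType) (K : nat) (g : dist R ('I_2 * 'I_2)%type) :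
    dist R ('I_K.+1 * 'I_K.+1)%type :=
  push (@heads K) (mn K g).
Arguments bvbn {R} K g.

(* The two projections {0,...,n-1}^2 -> {0,...,n-1} as real-valued
   observables; the index is 0-based: i = 0 is the first one, i = 1 the
   second. *)
Definition proj (R : realType) (n : nat) (i : 'I_2) (x : 'I_n * 'I_n) : R :=
  (if i == 0 then x.1 else x.2)%:R.
Arguments proj {R n} i x.

(* Main.v *)
Require Import Defs.
From mathcomp Require Import all_boot all_order all_algebra.
From mathcomp Require Import reals ring.

(** Each of the [K] draws counted by the multinomial distribution contributes
    independently, so a total score over the draws has the probability
    generating function of a single draw raised to the power [K]
    ([pgf_mn]); this is the multinomial theorem with weights
    [w x * s ^+ a x].  The first two derivatives at [1] of a generating function
    determine the variance ([var_pgf]), and under a [K]-th power this expression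
    gets multiplied by [K] ([var_pgf_exp]).  Hence the variance of every
    total score scales by [K] ([var_mn]).

    Each coordinate of [heads phi] is the total of the scores [x.1] or [x.2]
    over [phi], which gives the variances.  The covariances need no mixed
    moments: by polarisation, they follow from the variances of the two scores
    and of their sum ([cov_polarisation]). *)

Set Implicit Arguments.
Unset Strict Implicit.
Unset Printing Implicit Defensive.

Import GRing.Theory Num.Theory.
Local Open Scope ring_scope.

Lemma poly_eq_horner (R : numDomainType) (p q : {poly R}) :
  (forall s, p.[s] = q.[s]) -> p = q.
Proof.
move=> pq; apply/eqP; rewrite -subr_eq0; apply/eqP.
(* In characteristic 0 the natural numbers are enough distinct roots. *)
pose rs := [seq n%:R : R | n <- iota 0 (size (p - q))].
apply: (@roots_geq_poly_eq0 _ _ rs); last by rewrite size_map size_iota.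
  by apply/allP => s _; rewrite rootE !hornerE pq subrr.
by rewrite map_inj_uniq ?iota_uniq // => m n /eqP; rewrite eqr_nat => /eqP.
Qed.

Section Validity.
Variables (R : realType) (X : finType) (w : dist R X).

Lemma eq_validity (p q : X -> R) : p =1 q -> validity w p = validity w q.
Proof. by move=> pq; apply: eq_bigr => x _; rewrite pq. Qed.

Lemma validityD (p q : X -> R) :
  validity w (fun x => p x + q x) = validity w p + validity w q.
Proof. by rewrite -big_split; apply: eq_bigr => x _; rewrite mulrDr. Qed.

Lemma eq_var (p q : X -> R) : p =1 q -> var w p = var w q.
Proof.
by move=> pq; rewrite /var (eq_validity pq); congr (_ - _);
  apply: eq_validity => x /=; rewrite pq.
Qed.

Lemma cov_polarisation (p q : X -> R) :
  cov w p q = (var w (fun x => p x + q x) - var w p - var w q) / 2.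
Proof.
rewrite /cov /var validityD.
have -> : validity w ((fun x => p x + q x) \* (fun x => p x + q x)) =
    validity w (p \* p) + validity w (p \* q) +
    (validity w (p \* q) + validity w (q \* q)).
  by rewrite -!validityD; apply: eq_validity => x /=; ring.
by field.
Qed.

End Validity.

Section ValidityPush.
Variables (R : realType) (X Y : finType) (f : X -> Y) (w : dist R X).

Lemma validity_push (p : Y -> R) : validity (push f w) p = validity w (p \o f).
Proof.
rewrite /validity [RHS](partition_big f xpredT) //=.
by apply: eq_bigr => y _; rewrite mulr_suml; apply: eq_bigr => x /eqP <-.
Qed.

Lemma var_push (p : Y -> R) : var (push f w) p = var w (p \o f).
Proof. by rewrite /var !validity_push. Qed.

End ValidityPush.

Section GeneratingFunction.
Variables (R : realType) (X : finType) (w : dist R X) (a : X -> nat).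

Definition pgf : {poly R} := \sum_x w x *: 'X^(a x).

Lemma pgf1 : pgf.[1] = 1.
Proof.
rewrite -[RHS](dist_sum1 w) horner_sum; apply: eq_bigr => x _.
by rewrite hornerZ hornerXn expr1n mulr1.
Qed.

Lemma deriv_pgf1 : pgf^`().[1] = validity w (fun x => (a x)%:R).
Proof.
rewrite linear_sum /= horner_sum; apply: eq_bigr => x _.
by rewrite derivZ derivXn hornerZ hornerMn hornerXn expr1n.
Qed.

(** The second derivative yields the factorial moment of [a * (a - 1)]; adding
    the first one completes it to the moment of [a ^ 2]. *)
Lemma deriv2_pgf1 :
  pgf^`()^`().[1] + pgf^`().[1] = validity w (fun x => (a x)%:R * (a x)%:R).
Proof.
rewrite deriv_pgf1 linear_sum /= linear_sum /= horner_sum -big_split /=.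
apply: eq_bigr => x _.
rewrite !derivZ derivXn derivMn derivXn hornerZ !hornerMn hornerXn expr1n.
rewrite -mulrnA; case: (a x) => [|n] /=; first by rewrite muln0; ring.
by rewrite natrM -!natr1; ring.
Qed.

Lemma var_pgf :
  var w (fun x => (a x)%:R) =
  pgf^`()^`().[1] + pgf^`().[1] - pgf^`().[1] ^+ 2.
Proof. by rewrite deriv2_pgf1 deriv_pgf1. Qed.

End GeneratingFunction.

(** The generating function of a sum of [K] independent copies of a score is
    the [K]-th power; this is the additivity of the variance for such sums. *)
Lemma var_pgf_exp (R : realType) (X Y : finType) (w : dist R X) (v : dist R Y)
    (a : X -> nat) (b : Y -> nat) (K : nat) :
  pgf v b = pgf w a ^+ K ->
  var v (fun y => (b y)%:R) = K%:R * var w (fun x => (a x)%:R).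
Proof.
move=> vw; rewrite !var_pgf vw deriv_exp derivMn derivM deriv_exp.
rewrite !(hornerMn, hornerD, hornerM, horner_exp) pgf1 !expr1n.
case: K {vw} => [|K] /=; first by rewrite !mulr0n; ring.
by ring.
Qed.

Lemma multinomial_mset (R : numFieldType) (X : finType) (K : nat) (u : X -> R) :
  \sum_(phi : mset K X)
     K`!%:R / (\prod_x (phi x)`!)%N%:R * \prod_x u x ^+ phi x =
  (\sum_x u x) ^+ K.
Proof.
have fK : K`!%:R != 0 :> R by rewrite pnatr_eq0 -lt0n fact_gt0.
rewrite -[RHS](divfK fK) -(multinomial_bounded u (leqnn K)) mulr_suml.
rewrite [RHS](reindex_omap (@mset_val K X) insub) /=; last first.
  by move=> phi szphi; rewrite insubT.
rewrite [RHS](eq_bigl xpredT) => [|phi]; last first.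
  by rewrite mset_size eqxx /= (valK phi) eqxx.
apply: eq_bigr => phi _.
by rewrite big_split /= prodfV -natr_prod; ring.
Qed.

Definition total (K : nat) (X : finType) (a : X -> nat) (phi : mset K X) : nat :=
  (\sum_x a x * phi x)%N.

(** At a point [s], this is the multinomial theorem: the monomial of [phi] in the
    weights [w x * s ^+ a x] collects exactly the power [s ^+ total a phi]. *)
Lemma pgf_mn (R : realType) (X : finType) (K : nat) (w : dist R X)
    (a : X -> nat) :
  pgf (mn K w) (@total K X a) = pgf w a ^+ K.
Proof.
apply: poly_eq_horner => s; rewrite horner_exp !horner_sum.
under [in RHS]eq_bigr do rewrite hornerZ hornerXn.
rewrite -multinomial_mset; apply: eq_bigr => phi _.
rewrite hornerZ hornerXn /= /mn_fun -[LHS]mulrA; congr (_ * _).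
under [in RHS]eq_bigr do rewrite exprMn -exprM.
by rewrite big_split /= prodrXr.
Qed.

Lemma var_mn (R : realType) (X : finType) (K : nat) (w : dist R X)
    (a : X -> nat) :
  var (mn K w) (fun phi => (total a phi)%:R) =
  K%:R * var w (fun x => (a x)%:R).
Proof. exact/var_pgf_exp/pgf_mn. Qed.

Lemma totalD (K : nat) (X : finType) (a b : X -> nat) (phi : mset K X) :
  total (fun x => a x + b x)%N phi = (total a phi + total b phi)%N.
Proof. by rewrite -big_split; apply: eq_bigr => x _; rewrite mulnDl. Qed.

Definition coord (n : nat) (i : 'I_2) (x : 'I_n * 'I_n) : nat :=
  if i == 0 then x.1 else x.2.

Lemma coord_heads (K : nat) (i : 'I_2) (phi : mset K ('I_2 * 'I_2)%type) :
  coord i (heads phi) = total (coord i) phi.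
Proof.
transitivity (\sum_x \sum_y coord i (x, y) * phi (x, y))%N; last first.
  by rewrite pair_bigA; apply: eq_bigr => -[].
rewrite !big_ord_recl !big_ord0 /coord /=.
have -> : lift ord0 ord0 = 1 :> 'I_2 by apply: val_inj.
by case: (i == 0); rewrite /= !mul0n !mul1n !addn0.
Qed.

Theorem theorem4p2 (R : realType) (K : nat) (gamma : dist R ('I_2 * 'I_2)%type)
    (i j : 'I_2) :
  var (bvbn K gamma) (proj i) = K%:R * var gamma (proj i) /\
  cov (bvbn K gamma) (proj i) (proj j) = K%:R * cov gamma (proj i) (proj j).
Proof.
have var_proj k : var (bvbn K gamma) (proj k) = K%:R * var gamma (proj k).
  rewrite var_push -[RHS](var_mn K gamma (coord k)).
  by apply: eq_var => phi; rewrite -coord_heads.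
split; first exact: var_proj.
rewrite !cov_polarisation !var_proj.
have -> : var (bvbn K gamma) (fun x => proj i x + proj j x) =
    K%:R * var gamma (fun x => proj i x + proj j x).
  rewrite var_push.
  transitivity (K%:R * var gamma (fun x => (coord i x + coord j x)%:R)).
    rewrite -var_mn; apply: eq_var => phi.
    by rewrite totalD -!coord_heads natrD.
  by congr (_ * _); apply: eq_var => x; rewrite natrD.
by ring.
Qed.
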